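(* Let $0<l<1$. Let $L_0:L^2([0,1],\mathbb C)\to L^2([0,1],\mathbb C)$, $L_0f(x)=\int k_0(x,y)f(y)\,dy$, be an integral operator with stochastic kernel $k_0\in L^2([0,1]^2,\mathbb R)$, satisfying (A1): $\lim_{n\to\infty}\|L_0^ng\|_2=0$ for every $g$ with $\int g\,dm=0$. Let $\lambda_0\in\mathbb C$ be a geometrically simple eigenvalue of $L_0$ strictly inside the unit circle, and let $e$ and $\hat e$ be corresponding eigenvectors of $L_0$ and $L_0^*$, respectively (both for the eigenvalue $\lambda_0$). Put $$E(x,y):=\big(\Re(\hat e)(x)\Re(e)(y)+\Im(\hat e)(x)\Im(e)(y)\big)\Re(\lambda_0)+\big(\Im(\hat e)(x)\Re(e)(y)-\Re(\hat e)(x)\Im(e)(y)\big)\Im(\lambda_0).$$ Suppose there is $\Xi'\subset\Xi(F_l)$ with $m(\Xi')>0$ such that $\int_{F_l^y}E(x,y)^+\,dx>0$ and $\int_{F_l^y}E(x,y)^-\,dx>0$ for $y\in\Xi'$. Then the optimisation problem $$\min_{\dot k\in V_{\ker}\cap S_{k_0,l}}\langle\dot k,E\rangle_{L^2([0,1]^2,\mathbb R)}\quad\text{such that}\quad\|\dot k\|^2_{L^2([0,1]^2,\mathbb R)}-1=0$$ has the unique solution $$\dot k(x,y)=\begin{cases}\dfrac1\alpha\left(\dfrac1{m(F_l^y)}\displaystyle\int_{F_l^y}E(z,y)\,dz-E(x,y)\right)&(x,y)\in F_l,\\[2mm]0&\text{otherwise},\end{cases}$$ where $\alpha>0$ is selected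 so that $\|\dot k\|_{L^2([0,1]^2,\mathbb R)}=1$. Furthermore, if $k_0\in L^\infty([0,1]^2,\mathbb R)$ then $\dot k\in L^\infty([0,1]^2,\mathbb R)$.
   Context: $m$ is Lebesgue measure on $[0,1]$. A stochastic kernel is a nonnegative $k$ with $\int k(x,y)\,dx=1$ for a.e. $y$. $V_{\ker}:=\{k\in L^2([0,1]^2,\mathbb R):\int k(x,y)\,dx=0\text{ for a.e. }y\}$. $F_l:=\{(x,y)\in[0,1]^2:k_0(x,y)\ge l\}$; $F_l^y:=\{x\in[0,1]:(x,y)\in F_l\}$; $\Xi(F_l):=\{y\in[0,1]:m(F_l^y)>0\}$; $S_{k_0,l}:=\{k\in L^2([0,1]^2,\mathbb R):\mathrm{supp}(k)\subseteq F_l\}$, where $\mathrm{supp}(k)\subseteq F_l$ means $k=0$ a.e. outside $F_l$. $L_0^*g(y)=\int k_0(x,y)g(x)\,dx$ is the adjoint of $L_0$. $E^+,E^-$ are the positive and negative parts of $E$. Equalities of kernels are a.e. *)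

(* Defs.v *)
From HB Require Import structures.
From mathcomp Require Import all_boot all_order all_algebra.
From mathcomp Require Import all_classical all_reals all_analysis.
From mathcomp Require Import complex.

Set Implicit Arguments.
Unset Strict Implicit.
Unset Printing Implicit Defensive.

Import Order.TTheory GRing.Theory Num.Theory.
Import numFieldNormedType.Exports.

Local Open Scope classical_set_scope.
Local Open Scope ring_scope.
Local Open Scope complex_scope.

Lemma lebesgue_itv01_lty (R : realType) :
  (@lebesgue_measure R `[0%R, 1%R]%classic < +oo)%E.
Proof. by rewrite lebesgue_measure_itv/= lte_fin ltr01 oppr0 adde0 ltry. Qed.

(* Lebesgue measure on [0, 1], as a finite measure on the real line that is
   concentrated on [0, 1]: a function on [0, 1] is represented by any
   measurable extension to the real line, and an almost-everywhere statement
   for [leb01] is one about almost every point of [0, 1]. *)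
Definition leb01 (R : realType) :
    {finite_measure set (measurableTypeR R) -> \bar R} :=
  @mfrestr _ (measurableTypeR R) R _ _
    (measurable_itv `[0%R, 1%R]) (@lebesgue_itv01_lty R).

Definition leb01sq (R : realType) :
    {measure set (measurableTypeR R * measurableTypeR R) -> \bar R} :=
  (@leb01 R \x @leb01 R)%E.

Section kernels.
Context {R : realType}.
Local Notation T := (measurableTypeR R).
Local Notation m := (@leb01 R).
Local Notation m2 := (@leb01sq R).
Implicit Types (k : T * T -> R) (f g e : T -> R[i]) (F : set (T * T)).

Definition L2C f : Prop :=
  (fun x => complex.Re (f x)) \in Lfun m 2%:E /\
  (fun x => complex.Im (f x)) \in Lfun m 2%:E.

Definition L2Cnorm f : \bar R :=
  'N[m]_2%:E [EFin \o (fun x => Normc.normc (f x))]%E.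

Definition cintegral f : R[i] :=
  (\int[m]_x complex.Re (f x)) +i* (\int[m]_x complex.Im (f x)).

Definition integral_op k f : T -> R[i] :=
  fun x => cintegral (fun y => (k (x, y))%:C * f y).

Definition integral_op_adj k g : T -> R[i] :=
  fun y => cintegral (fun x => (k (x, y))%:C * g x).

Definition stochastic_kernel k : Prop :=
  (\forall z \ae m2, 0 <= k z) /\
  (\forall y \ae m, \int[m]_x (k (x, y))%:E = 1)%E.

Definition mixing (L : (T -> R[i]) -> T -> R[i]) : Prop :=
  forall g, L2C g -> cintegral g = 0 ->
    L2Cnorm (iter n L g) @[n --> \oo] --> 0%E.

Definition eigenvector (L : (T -> R[i]) -> T -> R[i]) (lambda : R[i]) e : Prop :=
  [/\ L2C e,
      ~ (\forall x \ae m, e x = 0) &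
      \forall x \ae m, L e x = lambda * e x].

Definition geometrically_simple_eigenvalue
    (L : (T -> R[i]) -> T -> R[i]) (lambda : R[i]) : Prop :=
  exists e, eigenvector L lambda e /\
    forall f, L2C f -> (\forall x \ae m, L f x = lambda * f x) ->
      exists c : R[i], \forall x \ae m, f x = c * e x.

Definition Vker : set (T * T -> R) :=
  [set k | k \in Lfun m2 2%:E /\ (\forall y \ae m, \int[m]_x (k (x, y))%:E = 0)%E].

Definition Flev k (l : R) : set (T * T) :=
  [set z | [/\ z.1 \in `[0, 1], z.2 \in `[0, 1] & l <= k z]].

Definition Xi F : set T :=
  [set y | y \in `[0, 1] /\ (0 < m (ysection F y))%E].

Definition supported_in F : set (T * T -> R) :=
  [set k | k \in Lfun m2 2%:E /\ (\forall z \ae m2, ~ F z -> k z = 0)].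

Definition dotL2 k1 k2 : R := \int[m2]_z (k1 z * k2 z).

Definition normL2 k : \bar R := 'N[m2]_2%:E [EFin \o k]%E.

Definition Ekernel (lambda : R[i]) (e ehat : T -> R[i]) : T * T -> R := fun z =>
  (complex.Re (ehat z.1) * complex.Re (e z.2)
   + complex.Im (ehat z.1) * complex.Im (e z.2)) * complex.Re lambda
  + (complex.Im (ehat z.1) * complex.Re (e z.2)
     - complex.Re (ehat z.1) * complex.Im (e z.2)) * complex.Im lambda.

Definition minimiser (A : set (T * T -> R)) (J : (T * T -> R) -> R) k : Prop :=
  A k /\ forall k', A k' -> J k <= J k'.

Definition unique_minimiser (A : set (T * T -> R)) (J : (T * T -> R) -> R) k :
    Prop :=
  minimiser A J k /\
  forall k', minimiser A J k' -> \forall z \ae m2, k' z = k z.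

Definition admissible k0 (l : R) : set (T * T -> R) :=
  (Vker `&` supported_in (Flev k0 l)) `&` [set k | (normL2 k ^+ 2 - 1 = 0)%E].

(* When [m (ysection F z.2) = 0], the quotient is read with [0^-1 = 0]; the
   points of [F] concerned form a null set. *)
Definition kdot F (E : T * T -> R) (alpha : R) : T * T -> R := fun z =>
  if z \in F then
    alpha^-1 * ((fine (m (ysection F z.2)))^-1
                * (\int[m]_(x in ysection F z.2) E (x, z.2)) - E z)
  else 0.

End kernels.

(* Main.v *)
(* Let h be kdot with alpha = 1: at (x, y) in F it is the mean of E(., y) over
   the section F^y minus E(x, y), and it vanishes off F.  Thus, on F, E + h depends
   on y only, so every k in V_ker supported in F is orthogonal to E + h, that is
   <k, E> = - <k, h>.  By Cauchy-Schwarz the minimum on the unit sphere is then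
   attained exactly at the normalisation of h.  The sign conditions prevent
   E(., y) from being constant on F^y for y in Xi', whence h <> 0.  When k0 is
   bounded and lambda0 <> 0 the eigenvectors are bounded, being multiples of their
   images under L_0 and its adjoint, hence so are E and h; when lambda0 = 0, E
   vanishes. *)
Require Import Defs.
From mathcomp Require Import all_boot all_order all_algebra.
From mathcomp Require Import all_classical all_reals all_analysis.
From mathcomp Require Import measurable_realfun ess_sup_inf.
From mathcomp Require Import complex.
From mathcomp Require Import ring.

Set Implicit Arguments.
Unset Strict Implicit.
Unset Printing Implicit Defensive.

Import Order.TTheory GRing.Theory Num.Theory.
Import numFieldNormedType.Exports.

Local Open Scope classical_set_scope.
Local Open Scope ring_scope.

(** * Square-integrable functions and minimisation on the unit sphere *)

Section square_integrable.
Context d (T : measurableType d) (R : realType).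
Variable mu : {measure set T -> \bar R}.
Implicit Types f g h k : T -> R.

Lemma Lfun_measurable p f : f \in Lfun mu p -> measurable_fun setT f.
Proof. by rewrite inE => /andP[]; rewrite inE. Qed.

(** The identity is kept in the extended reals: an infinite norm squares to [+oo], so it can also be
    used to prove that a norm is finite. *)
Lemma Lnorm2_sqr f : ('N[mu]_2%:E[EFin \o f] ^+ 2 = \int[mu]_x (f x ^+ 2)%:E)%E.
Proof.
have -> : (\int[mu]_x (f x ^+ 2)%:E = 'N[mu]_2%:E[EFin \o f] `^ 2)%E.
  rewrite poweR_Lnorm//; apply: eq_integral => x _ /=.
  by rewrite powR_mulrn// -normrX ger0_norm// sqr_ge0.
have : (0 <= 'N[mu]_2%:E[EFin \o f])%E by exact: Lnorm_ge0.
case: ('N[mu]_2%:E[EFin \o f])%E => [r||//].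
  by rewrite lee_fin => r0; rewrite poweR_EFin powR_mulrn.
by move=> _; rewrite poweRyr ?pnatr_eq0//= expe2 mulyy.
Qed.

(** Brings membership in L2 down to the integral of the square, to which Tonelli's theorem
    applies. *)
Lemma Lfun2P f : f \in Lfun mu 2%:E <->
  measurable_fun setT f /\ mu.-integrable setT (EFin \o (fun x => f x ^+ 2)).
Proof.
split=> [fL|[mf /integrableP[_ fi]]].
  by split; [exact: Lfun_measurable fL|exact: Lfun2_integrable_sqr].
rewrite inE; apply/andP; split; rewrite inE//=.
rewrite /finite_norm; have := Lnorm2_sqr f.
under eq_integral do rewrite -[(_ ^+ 2)%R]ger0_norm ?sqr_ge0// -abse_EFin.
move=> fE; move: fi; rewrite -fE.
by case: ('N[mu]_2%:E[EFin \o f])%E => [r|//|//]; rewrite ?ltry// => _; rewrite ltNyr.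
Qed.

Lemma integrable_mul_Lfun2 f g : f \in Lfun mu 2%:E -> g \in Lfun mu 2%:E ->
  mu.-integrable setT (EFin \o (fun x => f x * g x)).
Proof. by move=> fL gL; apply/Lfun1_integrable/Lfun2_mul_Lfun1. Qed.

Lemma Lfun2B f g : f \in Lfun mu 2%:E -> g \in Lfun mu 2%:E ->
  (fun x => f x - g x) \in Lfun mu 2%:E.
Proof.
move=> fL gL; apply/Lfun2P; split.
  exact: measurable_funB (Lfun_measurable fL) (Lfun_measurable gL).
have fgi := integrable_mul_Lfun2 fL gL.
have ffi := integrable_mul_Lfun2 fL fL.
have ggi := integrable_mul_Lfun2 gL gL.
have := integrableB measurableT (integrableD measurableT ffi ggi)
  (integrableZl measurableT 2 fgi).
apply: eq_integrable => // x _ /=.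
by congr EFin; ring.
Qed.

Lemma Lfun2Z a f : f \in Lfun mu 2%:E -> (fun x => a * f x) \in Lfun mu 2%:E.
Proof.
move=> fL; have -> : (fun x => a * f x) = a \o* f.
  by apply/funext => x /=; rewrite mulrC.
by apply: Lfun_scale fL; rewrite ler1n.
Qed.

Lemma Rintegral_sqrB f g : f \in Lfun mu 2%:E -> g \in Lfun mu 2%:E ->
  \int[mu]_x (f x - g x) ^+ 2 =
  \int[mu]_x f x ^+ 2 - 2 * \int[mu]_x (f x * g x) + \int[mu]_x g x ^+ 2.
Proof.
move=> fL gL.
have fgi := integrable_mul_Lfun2 fL gL.
have ffi := Lfun2_integrable_sqr fL.
have ggi := Lfun2_integrable_sqr gL.
have fgi2 := integrableZl measurableT 2 fgi.
rewrite -RintegralZl// -RintegralB// -RintegralD//.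
  by apply: eq_Rintegral => x _; ring.
exact: (integrableB measurableT ffi fgi2).
Qed.

Lemma Rintegral_sqr_eq0 f : f \in Lfun mu 2%:E ->
  \int[mu]_x f x ^+ 2 = 0 -> \forall x \ae mu, f x = 0.
Proof.
move=> fL f20.
have fi := Lfun2_integrable_sqr fL.
have : (\int[mu]_x `|(f x ^+ 2)%:E| = 0)%E.
  under eq_integral do rewrite abse_EFin ger0_norm ?sqr_ge0//.
  by rewrite -[LHS]fineK; [rewrite -/(Rintegral _ _ _) f20|exact: integrable_fin_num].
move/(ae_eq_integral_abs mu measurableT (measurable_int mu fi)).
by apply: filterS => x /= /(_ I) [] /eqP; rewrite sqrf_eq0 => /eqP.
Qed.

(* On [W] the objective is [k |-> - alpha <k, u>], so the equality case of
   Cauchy-Schwarz on the unit sphere is read off the square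
   [|k - u|^2 = 2 - 2 <k, u>]. *)
Lemma unit_sphere_minimiser (W : set (T -> R)) h u E (alpha : R) :
  W `<=` [set k | k \in Lfun mu 2%:E] ->
  (forall k, W k -> \int[mu]_x (k x * E x) = - \int[mu]_x (k x * h x)) ->
  0 < alpha -> (forall x, h x = alpha * u x) ->
  let A := W `&` [set k | \int[mu]_x k x ^+ 2 = 1] in
  A u ->
  (forall k, A k -> \int[mu]_x (u x * E x) <= \int[mu]_x (k x * E x)) /\
  (forall k, A k -> \int[mu]_x (k x * E x) <= \int[mu]_x (u x * E x) ->
    \forall x \ae mu, k x = u x).
Proof.
move=> WL WE a0 hE A [Wu u1].
have uL := WL _ Wu.
have obj k : W k -> \int[mu]_x (k x * E x) = - (alpha * \int[mu]_x (k x * u x)).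
  move=> Wk; rewrite WE// -RintegralZl//; last exact: (integrable_mul_Lfun2 (WL _ Wk) uL).
  by congr (- _); apply: eq_Rintegral => x _; rewrite hE mulrCA.
have objE k : A k -> \int[mu]_x (k x - u x) ^+ 2 =
    2 * alpha^-1 * (\int[mu]_x (k x * E x) - \int[mu]_x (u x * E x)).
  move=> [Wk k1]; rewrite Rintegral_sqrB//; last exact: WL.
  rewrite !obj// k1 u1.
  by field; rewrite gt_eqF.
have c0 : 0 < 2 * alpha^-1 by rewrite mulr_gt0// invr_gt0.
split=> k Ak.
  have : 0 <= \int[mu]_x (k x - u x) ^+ 2 by apply: Rintegral_ge0 => x _; exact: sqr_ge0.
  by rewrite objE// pmulr_rge0// subr_ge0.
move=> kleu.
have kuL := Lfun2B (WL _ Ak.1) uL.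
have : \int[mu]_x (k x - u x) ^+ 2 = 0.
  apply/eqP; rewrite eq_le Rintegral_ge0 ?andbT; last by move=> x _; exact: sqr_ge0.
  by rewrite objE// pmulr_rle0// subr_le0.
move/(Rintegral_sqr_eq0 kuL); apply: filterS => x.
by move/eqP; rewrite subr_eq0 => /eqP.
Qed.

End square_integrable.

(** * Means over a set of finite measure *)

Section mean_on.
Context d (T : measurableType d) (R : realType).
Variable mu : {finite_measure set T -> \bar R}.
Implicit Types (D : set T) (f g k : T -> R) (c : R).

(** The average subtracted in [kdot]. By the convention [0^-1 = 0] it is 0 on a null set. *)
Definition mean_on D g : R := (fine (mu D))^-1 * \int[mu]_(x in D) g x.

(** If [D] is null both sides vanish, so sections of measure zero need no separate treatment
    later. *)
Lemma mean_onM D g : measurable D -> mu.-integrable D (EFin \o g) ->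
  mean_on D g * fine (mu D) = \int[mu]_(x in D) g x.
Proof.
move=> mD gi; rewrite /mean_on mulrAC.
have [D0|D0] := eqVneq (fine (mu D)) 0; last by rewrite mulVf// mul1r.
rewrite D0 mulr0 mul0r; apply/esym; rewrite /Rintegral.
have muD0 : mu D = 0 by rewrite -[LHS]fineK ?D0// fin_num_measure.
by rewrite null_set_integral//; exact: measurable_int gi.
Qed.

Lemma integral_centred D g : measurable D -> mu.-integrable D (EFin \o g) ->
  (\int[mu]_(x in D) (mean_on D g - g x)%:E = 0)%E.
Proof.
move=> mD gi.
have ci : mu.-integrable D (EFin \o cst (mean_on D g)).
  exact: finite_measure_integrable_cst.
rewrite -[LHS]fineK; last by apply: integrable_fin_num => //; exact: integrableB ci gi.
rewrite -[X in X%:E]/(\int[mu]_(x in D) (cst (mean_on D g) x - g x)).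
by rewrite RintegralB// Rintegral_cst// mean_onM// subrr.
Qed.

(** The variance identity: centring lowers the second moment by [a ^+ 2 * mu D], where [a] is the
    mean. Applied to sections, it bounds the L2 norm of [kdot] by that of [E]. *)
Lemma integral_centred_sqr_le D g : measurable D ->
  mu.-integrable D (EFin \o g) -> mu.-integrable D (EFin \o (fun x => g x ^+ 2)) ->
  (\int[mu]_(x in D) ((mean_on D g - g x) ^+ 2)%:E <=
   \int[mu]_(x in D) (g x ^+ 2)%:E)%E.
Proof.
move=> mD gi g2i; set a := mean_on D g.
have ci : mu.-integrable D (EFin \o cst (a ^+ 2)).
  exact: finite_measure_integrable_cst.
have agi := integrableZl mD (2 * a) gi.
have cagi := integrableB mD ci agi.
have sqrE x : (a - g x) ^+ 2 = a ^+ 2 - 2 * a * g x + g x ^+ 2 by ring.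
under eq_integral do rewrite sqrE.
have i3 : mu.-integrable D (EFin \o (fun x => a ^+ 2 - 2 * a * g x + g x ^+ 2)).
  exact: (integrableD mD cagi g2i).
rewrite -[leLHS]fineK; last exact: integrable_fin_num.
rewrite -[leRHS]fineK; last exact: integrable_fin_num.
rewrite lee_fin -/(Rintegral _ _ _) -/(Rintegral _ _ _).
rewrite RintegralD// RintegralB// RintegralZl// Rintegral_cst// -mean_onM// -/a.
rewrite gerDr (_ : _ - _ = - (a ^+ 2 * fine (mu D))); last by ring.
by rewrite oppr_le0 mulr_ge0// ?sqr_ge0// fine_ge0.
Qed.

Lemma normr_mean_on_le D g c : measurable D -> measurable_fun D g -> 0 <= c ->
  {ae mu, forall x, D x -> `|g x| <= c} -> `|mean_on D g| <= c.
Proof.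
move=> mD mg c0 gc.
have le_c : (\int[mu]_(x in D) `|(g x)%:E| <= c%:E * mu D)%E.
  by apply: integral_le_bound => //; exact/measurable_EFinP.
have muDfin : mu D \is a fin_num by rewrite fin_num_measure.
have gi : mu.-integrable D (EFin \o g).
  apply/integrableP; split; first exact/measurable_EFinP.
  by rewrite (le_lt_trans le_c)// ltey_eq fin_numM.
(* On a null set the mean is 0, which is at most [c] because [c] is nonnegative. *)
have [D0|D0] := eqVneq (fine (mu D)) 0; first by rewrite /mean_on D0 invr0 mul0r normr0.
have Dgt0 : 0 < fine (mu D) by rewrite lt_neqAle eq_sym D0 fine_ge0.
rewrite -(ler_pM2r Dgt0) -[X in _ * X <= _]ger0_norm ?fine_ge0// -normrM mean_onM//.
rewrite -lee_fin EFin_normr_Rintegral// EFinM fineK// (le_trans _ le_c)//.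
by apply: le_abse_integral => //; exact/measurable_EFinP.
Qed.

(** Hölder's inequality for the exponents infinity and 1. It makes a bounded kernel send integrable
    functions to bounded ones. *)
Lemma normr_Rintegral_mul_le k g c : 0 <= c ->
  measurable_fun setT k -> mu.-integrable setT (EFin \o g) ->
  {ae mu, forall x, `|k x| <= c} ->
  `|\int[mu]_x (k x * g x)| <= c * \int[mu]_x `|g x|.
Proof.
move=> c0 mk gi kc.
have mg : measurable_fun setT g by apply/measurable_EFinP; exact: measurable_int gi.
have mkg : measurable_fun setT (EFin \o (fun x => k x * g x)).
  by apply/measurable_EFinP; exact: measurable_funM.
have cgi := integrableZl measurableT c (integrable_norm gi).
have le_c : (\int[mu]_x `|(k x * g x)%:E| <= \int[mu]_x (c%:E * `|g x|%:E))%E.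
  apply: ae_ge0_le_integral => //.
  - exact: measurableT_comp.
  - by move=> x _; rewrite mule_ge0// lee_fin.
  - exact: measurable_int cgi.
  - by apply: filterS kc => x kxc _; rewrite lee_fin normrM ler_wpM2r.
have kgi : mu.-integrable setT (EFin \o (fun x => k x * g x)).
  by apply/integrableP; split=> //; rewrite (le_lt_trans le_c)// integrable_lty.
rewrite -RintegralZl//; last exact: integrable_norm.
rewrite -lee_fin EFin_normr_Rintegral//.
rewrite fineK; last exact: (integrable_fin_num measurableT cgi).
by rewrite (le_trans _ le_c)// le_abse_integral.
Qed.

End mean_on.

(** * Null sets, sections and tensor products on a product space *)

Section almost_everywhere_sections.
Context d1 d2 (T1 : measurableType d1) (T2 : measurableType d2) (R : realType).
Variable m1 : {sigma_finite_measure set T1 -> \bar R}.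
Variable m2 : {sigma_finite_measure set T2 -> \bar R}.
Implicit Type P : T1 * T2 -> Prop.

(** The measures of the sections of a null set integrate to 0, so almost all of them are 0. *)
Lemma ae_xsection P : {ae (m1 \x m2)%E, forall z, P z} ->
  {ae m1, forall x, {ae m2, forall y, P (x, y)}}.
Proof.
move=> [N [mN N0 PN]].
have mNs : measurable_fun setT (m2 \o xsection N) by exact: measurable_fun_xsection.
have : (\int[m1]_x `|(m2 \o xsection N) x| = 0)%E.
  by under eq_integral do rewrite gee0_abs//.
move/(ae_eq_integral_abs m1 measurableT mNs); apply: filterS => x /(_ I) Nx0.
exists (xsection N x); split => //; first exact: measurable_xsection.
by move=> y Pxy; rewrite /xsection/= inE; exact: PN.
Qed.

Lemma ae_ysection P : {ae (m1 \x m2)%E, forall z, P z} ->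
  {ae m2, forall y, {ae m1, forall x, P (x, y)}}.
Proof.
move=> [N [mN N0 PN]].
have mNs : measurable_fun setT (m1 \o ysection N) by exact: measurable_fun_ysection.
have : (\int[m2]_y `|(m1 \o ysection N) y| = 0)%E.
  under eq_integral do rewrite gee0_abs//.
  (* The product measure is defined by integrating the sections at fixed first coordinate; Tonelli's
     theorem for the indicator of [N] exchanges the order. *)
  rewrite -N0 -indic_fubini_tonelli_GE// -indic_fubini_tonelli//.
  by rewrite indic_fubini_tonelli_FE.
move/(ae_eq_integral_abs m2 measurableT mNs); apply: filterS => y /(_ I) Ny0.
exists (ysection N y); split => //; first exact: measurable_ysection.
by move=> x Pxy; rewrite /ysection/= inE; exact: PN.
Qed.

(** A cylinder over a null set is null, also when [m2 setT] is infinite, since 0 times [+oo] is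
    0. *)
Lemma ae_fst (P : T1 -> Prop) : {ae m1, forall x, P x} ->
  {ae (m1 \x m2)%E, forall z, P z.1}.
Proof.
move=> [N [mN N0 PN]]; exists (N `*` setT); split; first exact: measurableX.
  by transitivity (m1 N * m2 setT)%E; [exact: product_measure1E|rewrite N0 mul0e].
by move=> z Pz; split=> //; exact: PN.
Qed.

Lemma ae_snd (P : T2 -> Prop) : {ae m2, forall y, P y} ->
  {ae (m1 \x m2)%E, forall z, P z.2}.
Proof.
move=> [N [mN N0 PN]]; exists (setT `*` N); split; first exact: measurableX.
  by transitivity (m1 setT * m2 N)%E; [exact: product_measure1E|rewrite N0 mule0].
by move=> z Pz; split=> //; exact: PN.
Qed.

(** By Tonelli's theorem the integral of the square factorises. *)
Lemma Lfun2_tensor (u : T1 -> R) (v : T2 -> R) :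
  u \in Lfun m1 2%:E -> v \in Lfun m2 2%:E ->
  (fun z => u z.1 * v z.2) \in Lfun (m1 \x m2)%E 2%:E.
Proof.
move=> /Lfun2P[mu ui] /Lfun2P[mv vi].
have muv : measurable_fun setT (fun z : T1 * T2 => u z.1 * v z.2).
  by apply: measurable_funM; exact: measurableT_comp.
apply/Lfun2P; split=> //; apply/integrable12ltyP.
  by apply/measurable_EFinP; exact: measurable_funX.
have uv x : (\int[m2]_y `|((u x * v y) ^+ 2)%:E| =
    (u x ^+ 2)%:E * \int[m2]_y (v y ^+ 2)%:E)%E.
  rewrite -integralZl//; apply: eq_integral => y _.
  by rewrite abse_EFin ger0_norm ?sqr_ge0// exprMn EFinM.
rewrite /=; under eq_integral do rewrite uv.
have vfin := integrable_fin_num measurableT vi.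
rewrite -(fineK vfin) integralZr//.
by rewrite ltey_eq fin_numM// integrable_fin_num.
Qed.

End almost_everywhere_sections.

(** * Essentially bounded functions *)

Section essentially_bounded.
Context d (T : measurableType d) (R : realType).
Variable mu : {measure set T -> \bar R}.
Implicit Type f : T -> R.

Lemma Lfun_inftyP f : f \in Lfun mu +oo%E <->
  measurable_fun setT f /\ exists2 c, 0 <= c & {ae mu, forall x, `|f x| <= c}.
Proof.
split=> [fL|[mf [c c0 fc]]].
  split; first exact: Lfun_measurable fL.
  (* On a space of measure zero the norm is set to 0 instead of the essential supremum, and any
     bound holds almost everywhere. *)
  have [mu0|mu0] := ltP 0%E (mu setT); last first.
    exists 0 => //; exists setT; split => //.
    by apply/eqP; rewrite eq_le mu0 measure_ge0.
  (* The bound obtained from the essential supremum comes without a sign, hence the maximum with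
     0. *)
  have : (ess_sup mu (EFin \o (Num.norm \o f)) < +oo)%E.
    by move: fL; rewrite inE => /andP[_]; rewrite inE/= /finite_norm unlock mu0.
  move=> /ess_supr_bounded[c fc]; exists (Num.max c 0); first by rewrite le_max lexx orbT.
  by apply: filterS fc => x /= fxc; rewrite le_max fxc.
rewrite inE; apply/andP; split; rewrite inE//= /finite_norm unlock.
case: ifPn => // _; apply: (@le_lt_trans _ _ c%:E); last exact: ltry.
by apply/ess_supP; apply: filterS fc => x fxc /=; rewrite lee_fin.
Qed.

End essentially_bounded.

(** * The candidate kernel: measurability, integrability, constraints and objective *)

Section kdot.
Context {R : realType}.
Local Notation T := (measurableTypeR R).
Local Notation m := (@leb01 R).
Local Notation m2 := (@leb01sq R).
Implicit Types (F : set (T * T)) (E k : T * T -> R).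

Lemma leb01sq_setT_fin_num : m2 setT \is a fin_num.
Proof.
rewrite -setXTT (_ : m2 _ = m setT * m setT)%E; last exact: product_measure1E.
by rewrite fin_numM// fin_num_measure.
Qed.

Lemma Lfun2_integrable E : E \in Lfun m2 2%:E -> m2.-integrable setT (EFin \o E).
Proof.
by move=> EL; apply/Lfun1_integrable/Lfun_subset12 => //; exact: leb01sq_setT_fin_num.
Qed.

(** Since [alpha] only rescales, the properties of [kdot] are established for [alpha = 1] and
    transferred. *)
Lemma kdotZ F E alpha : kdot F E alpha = fun z => alpha^-1 * kdot F E 1 z.
Proof.
by apply/funext => z; rewrite /kdot; case: ifPn; rewrite ?mulr0// invr1 mul1r.
Qed.

Lemma kdot1E F E z : kdot F E 1 z =
  \1_F z * (mean_on m (ysection F z.2) (fun x => E (x, z.2)) - E z).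
Proof. by rewrite /kdot indicE invr1 mul1r; case: ifPn; rewrite ?mul1r ?mul0r. Qed.

(** At fixed [y] the kernel is the centred section of [E] extended by zero, which opens it to the
    lemmas on [mean_on]. *)
Lemma kdot1_ysection F E y : (fun x => kdot F E 1 (x, y)) =
  (fun x => mean_on m (ysection F y) (fun x => E (x, y)) - E (x, y)) \_ (ysection F y).
Proof.
by apply/funext => x; rewrite patchE mem_ysection /kdot invr1 mul1r.
Qed.

Lemma measurable_mean_on_ysection F E : measurable F -> m2.-integrable setT (EFin \o E) ->
  measurable_fun setT (fun y => mean_on m (ysection F y) (fun x => E (x, y))).
Proof.
move=> mF Ei; apply: measurable_funM.
  (* The inverse is written as a real power, a measurable function; at 0 both are 0. *)
  have -> : (fun y => (fine (m (ysection F y)))^-1) =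
      (fun r => r `^ (-1)) \o (fine \o (m \o ysection F)).
    by apply/funext => y /=; rewrite powR_inv1// fine_ge0.
  apply: measurableT_comp; first exact: measurable_powR.
  by apply: measurableT_comp => //; exact: measurable_fun_ysection.
(* The integrals of [E] over the sections of [F] are those of [E \_ F] over whole lines, measurable
   in [y] by Fubini's theorem. *)
have EFi : m2.-integrable setT (EFin \o (E \_ F)).
  by rewrite -restrict_EFin; apply/(integrable_mkcond _ mF); exact: integrableS Ei.
have := measurable_fubini_G EFi.
move/(measurableT_comp (@fine_measurable R _ measurableT)).
apply: eq_measurable_fun => y _.
rewrite /= [RHS]Rintegral_mkcond; congr fine; apply: eq_integral => x _ /=.
by rewrite !patchE mem_ysection.
Qed.

Lemma measurable_kdot F E alpha : measurable F -> m2.-integrable setT (EFin \o E) ->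
  measurable_fun setT (kdot F E alpha).
Proof.
move=> mF Ei; rewrite kdotZ; apply: measurable_funM => //.
have -> : kdot F E 1 = fun z =>
    \1_F z * (mean_on m (ysection F z.2) (fun x => E (x, z.2)) - E z).
  by apply/funext => z; exact: kdot1E.
apply: measurable_funM; first exact: measurable_indic.
apply: measurable_funB; last by apply/measurable_EFinP; exact: measurable_int Ei.
exact: (measurableT_comp (measurable_mean_on_ysection mF Ei) measurable_snd).
Qed.

Lemma ae_ysection_integrable E : m2.-integrable setT (EFin \o E) ->
  {ae m, forall y, m.-integrable setT (EFin \o (fun x => E (x, y)))}.
Proof. by move=> Ei; exact: (ae_integrable2 Ei). Qed.

(** The square is integrated in the first variable first: for almost every [y] the variance
    inequality bounds the inner integral by that of the square of [E]. *)
Lemma Lfun2_kdot F E alpha : measurable F -> E \in Lfun m2 2%:E ->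
  kdot F E alpha \in Lfun m2 2%:E.
Proof.
move=> mF EL; have Ei := Lfun2_integrable EL; rewrite kdotZ; apply: Lfun2Z.
have mk := measurable_kdot 1 mF Ei; apply/Lfun2P; split=> //.
have E2i := Lfun2_integrable_sqr EL.
apply/integrable21ltyP; first by apply/measurable_EFinP; exact: measurable_funX.
have E2lt : (\int[m]_y \int[m]_x `|(E (x, y) ^+ 2)%:E| < +oo)%E.
  by apply/(@integrable21ltyP _ _ _ _ _ m m (fun z => (E z ^+ 2)%:E));
    [exact: measurable_int E2i|exact: E2i].
apply: le_lt_trans E2lt.
have mG k : measurable_fun setT k ->
    measurable_fun setT (fun y => \int[m]_x `|(k (x, y) ^+ 2)%:E|)%E.
  move=> mf; apply: (measurable_fun_fubini_tonelli_G (fun z => `|(k z ^+ 2)%:E|%E)) => //.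
  by apply: measurableT_comp => //; apply/measurable_EFinP; exact: measurable_funX.
apply: ae_ge0_le_integral => //.
- by move=> y _; exact: integral_ge0.
- exact: mG.
- by move=> y _; exact: integral_ge0.
- by apply: mG; exact: Lfun_measurable EL.
have := ae_ysection_integrable E2i.
apply: filterS2 (ae_ysection_integrable Ei) => y Eyi E2yi _ /=.
set D := ysection F y; have mD : measurable D by exact: measurable_ysection.
have sub f : m.-integrable setT f -> m.-integrable D f by exact: integrableS.
apply: (@le_trans _ _ (\int[m]_(x in D) (E (x, y) ^+ 2)%:E)%E).
  apply: le_trans (integral_centred_sqr_le mD (sub _ Eyi) (sub _ E2yi)).
  rewrite [leRHS]integral_mkcond le_eqVlt; apply/orP; left; apply/eqP.
  apply: eq_integral => x _; rewrite patchE.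
  have := congr1 (fun f => f x) (kdot1_ysection F E y); rewrite /= patchE => ->.
  by case: ifPn => _; rewrite ?abse_EFin ger0_norm ?sqr_ge0 ?expr0n.
rewrite [leRHS](eq_integral (fun x => (E (x, y) ^+ 2)%:E)); last first.
  by move=> x _; rewrite /= ger0_norm ?sqr_ge0.
apply: ge0_subset_integral => //; last by move=> x _; rewrite lee_fin sqr_ge0.
exact: measurable_int E2yi.
Qed.

Lemma VkerZ a k : Vker k -> Vker (fun z => a * k z).
Proof.
move=> [kL k0]; split; first exact: Lfun2Z.
apply: filterS2 (ae_ysection_integrable (Lfun2_integrable kL)) k0 => y kyi ky0.
under eq_integral do rewrite EFinM.
by rewrite integralZl// ky0 mule0.
Qed.

(** On almost every line the integral is that of a centred function over the section, hence 0. *)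
Lemma Vker_kdot F E alpha : measurable F -> E \in Lfun m2 2%:E -> Vker (kdot F E alpha).
Proof.
move=> mF EL; rewrite kdotZ; apply: VkerZ; split; first exact: Lfun2_kdot.
apply: filterS (ae_ysection_integrable (Lfun2_integrable EL)) => y Eyi.
have mD : measurable (ysection F y) by exact: measurable_ysection.
rewrite -[RHS](integral_centred mD (integrableS measurableT mD (@subsetT _ _) Eyi)).
rewrite [RHS]integral_mkcond; apply: eq_integral => x _.
have := congr1 (fun f => f x) (kdot1_ysection F E y); rewrite /= !patchE => ->.
by case: ifPn.
Qed.

Lemma supported_in_kdot F E alpha : measurable F -> E \in Lfun m2 2%:E ->
  supported_in F (kdot F E alpha).
Proof.
move=> mF EL; split; first exact: Lfun2_kdot.
by apply: nearW => z Fz; rewrite /kdot memNset.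
Qed.

(* On [F] the function [E + kdot F E 1] is the sectional mean of [E], which
   depends on the second variable only; kernels in [Vker] annihilate it. *)
Lemma dotL2_kdot F E k : measurable F -> E \in Lfun m2 2%:E ->
  Vker k -> supported_in F k ->
  \int[m2]_z (k z * E z) = - \int[m2]_z (k z * kdot F E 1 z).
Proof.
move=> mF EL [kL kV] [_ kF].
have hL := Lfun2_kdot 1 mF EL.
have kEi := integrable_mul_Lfun2 kL EL; have khi := integrable_mul_Lfun2 kL hL.
apply/eqP; rewrite -addr_eq0 -RintegralD//; apply/eqP.
set f := fun z => k z * E z + k z * kdot F E 1 z.
have fi : m2.-integrable setT (EFin \o f) by exact: (integrableD measurableT kEi khi).
have mf : measurable_fun setT f by apply/measurable_EFinP; exact: measurable_int fi.
pose avg y := mean_on m (ysection F y) (fun x => E (x, y)).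
have f_avg : {ae m2, forall z, f z = k z * avg z.2}.
  apply: filterS kF => z; rewrite /f kdot1E indicE.
  have [Fz _|nFz /(_ nFz) ->] := pselect (F z); last by rewrite !mul0r addr0.
  by rewrite mem_set// mul1r /avg; ring.
rewrite /Rintegral -(integral21_prod_meas1 fi).
rewrite (ae_eq_integral (cst 0%E))//; first by rewrite integral0.
  exact: (measurable_fubini_G fi).
have ki := ae_ysection_integrable (Lfun2_integrable kL).
near=> y => _; rewrite /fubini_G /=.
have kyi : m.-integrable setT (EFin \o (fun x => k (x, y))) by near: y.
transitivity (\int[m]_x ((k (x, y))%:E * (avg y)%:E))%E.
  apply: ae_eq_integral => //.
  - by apply/measurable_EFinP; exact: measurable_fun_pair1.
  - by apply: emeasurable_funM => //; exact: measurable_int kyi.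
  - have : {ae m, forall x, f (x, y) = k (x, y) * avg y}.
      by near: y; exact: (ae_ysection f_avg).
    by apply: filterS => x fx _; rewrite fx EFinM.
have -> : (\int[m]_x ((k (x, y))%:E * (avg y)%:E) =
    (\int[m]_x (k (x, y))%:E) * (avg y)%:E)%E.
  by rewrite integralZr.
have -> : (\int[m]_x (k (x, y))%:E = 0)%E by near: y.
by rewrite mul0e.
Unshelve. all: by end_near. Qed.

(** If the kernel vanishes, then for almost every [y] the function [E(., y)] is almost everywhere
    equal to its mean on the section. A constant has a single sign, so its positive or its negative
    part integrates to 0. *)
Lemma kdot_eq0 F E : measurable F -> m2.-integrable setT (EFin \o E) ->
  {ae m2, forall z, kdot F E 1 z = 0} ->
  {ae m, forall y, ~ ((0 < \int[m]_(x in ysection F y) (E^\+ (x, y))%:E)%E /\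
                      (0 < \int[m]_(x in ysection F y) (E^\- (x, y))%:E)%E)}.
Proof.
move=> mF Ei /ae_ysection; apply: filterS => y h0 [].
set D := ysection F y; have mD : measurable D by exact: measurable_ysection.
set a := mean_on m D (fun x => E (x, y)).
have Ea : {ae m, forall x, D x -> E (x, y) = a}.
  apply: filterS h0 => x; have := congr1 (fun f => f x) (kdot1_ysection F E y).
  rewrite /= patchE => -> + Dx; rewrite mem_set// => /eqP.
  by rewrite subr_eq0 => /eqP.
have mE : measurable_fun setT E by apply/measurable_EFinP; exact: measurable_int Ei.
have zero (g : T * T -> R) : measurable_fun setT g ->
    (forall x, E (x, y) = a -> g (x, y) = 0) ->
    (\int[m]_(x in D) (g (x, y))%:E = 0)%E.
  move=> mg g0; rewrite (ae_eq_integral (cst 0%E))//; first by rewrite integral0.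
    apply/measurable_EFinP; apply: measurable_funTS.
    exact: measurable_fun_pair1.
  by apply: filterS Ea => x Exa Dx /=; rewrite g0// Exa.
have [a0|/ltW a0] := leP 0 a.
  move=> _; rewrite zero ?ltxx//; first exact: measurable_funrneg.
  by move=> x Exa; rewrite /funrneg Exa; apply/max_idPr; rewrite oppr_le0.
rewrite zero ?ltxx//; first exact: measurable_funrpos.
by move=> x Exa; rewrite /funrpos Exa; exact/max_idPr.
Qed.

Lemma Lfun_infty_kdot F E alpha : measurable F -> m2.-integrable setT (EFin \o E) ->
  E \in Lfun m2 +oo%E -> kdot F E alpha \in Lfun m2 +oo%E.
Proof.
move=> mF Ei /Lfun_inftyP[mE [c c0 Ec]].
apply/Lfun_inftyP; split; first exact: measurable_kdot.
(* One [c] bounds the sectional mean, the other bounds [E]. *)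
exists (`|alpha^-1| * (c + c)); first by rewrite mulr_ge0// addr_ge0.
have avg_le : {ae m, forall y,
    `|mean_on m (ysection F y) (fun x => E (x, y))| <= c}.
  apply: filterS (ae_ysection Ec) => y Eyc; apply: normr_mean_on_le => //.
  - exact: measurable_ysection.
  - by apply: measurable_funTS; exact: measurable_fun_pair1.
  - by apply: filterS Eyc => x.
apply: filterS2 Ec (ae_snd m avg_le) => z Ezc avgc.
rewrite kdotZ normrM ler_wpM2l// kdot1E indicE.
case: (z \in F); rewrite ?mul0r ?normr0 ?addr_ge0// mul1r.
by rewrite (le_trans (ler_normB _ _))// lerD.
Qed.

End kdot.

(** * Bounds on eigenvectors and on the kernel [E] *)

Section eigenvectors.
Context {R : realType}.
Local Notation T := (measurableTypeR R).
Local Notation m := (@leb01 R).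
Local Notation m2 := (@leb01sq R).
Implicit Types (k : T * T -> R) (e f : T -> R[i]).

(** As [s] is real, the real and imaginary parts decouple and each obeys the real inequality. *)
Lemma normr_cintegral_mul_le (s : T -> R) f c : L2C f -> 0 <= c ->
  measurable_fun setT s -> {ae m, forall x, `|s x| <= c} ->
  `|complex.Re (cintegral (fun x => (s x)%:C * f x)%C)| <=
    c * \int[m]_x `|complex.Re (f x)| /\
  `|complex.Im (cintegral (fun x => (s x)%:C * f x)%C)| <=
    c * \int[m]_x `|complex.Im (f x)|.
Proof.
have m_fin : m setT \is a fin_num by rewrite fin_num_measure.
move=> [/(Lfun_subset12 m_fin)/Lfun1_integrable Ri].
move=> /(Lfun_subset12 m_fin)/Lfun1_integrable Ii c0 ms sc /=.
have -> : \int[m]_x complex.Re ((s x)%:C * f x)%C = \int[m]_x (s x * complex.Re (f x)).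
  by apply: eq_Rintegral => x _; case: (f x) => a b /=; rewrite mul0r subr0.
have -> : \int[m]_x complex.Im ((s x)%:C * f x)%C = \int[m]_x (s x * complex.Im (f x)).
  by apply: eq_Rintegral => x _; case: (f x) => a b /=; rewrite mul0r addr0.
by split; exact: normr_Rintegral_mul_le.
Qed.

Lemma Re_Im_bounded_mulI (lambda : R[i]) f (c : R) : lambda != 0 -> 0 <= c ->
  {ae m, forall x, `|complex.Re (lambda * f x)| <= c /\
                   `|complex.Im (lambda * f x)| <= c} ->
  exists2 c', 0 <= c' & {ae m, forall x, `|complex.Re (f x)| <= c' /\
                                         `|complex.Im (f x)| <= c'}.
Proof.
move=> l0 c0 fc; case lE: (lambda^-1) => [p q].
(* With [p] and [q] the parts of the inverse of [lambda], both parts of [lambda^-1 * (lambda * f x)]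
   are estimated by the triangle inequality. *)
exists ((`|p| + `|q|) * c); first by rewrite mulr_ge0// addr_ge0.
apply: filterS fc => x; have := mulKf l0 (f x); rewrite lE mulrDl.
case: (lambda * f x) => a b <- /= [ac bc].
have bound u v s t : `|s| <= c -> `|t| <= c ->
    `|u * s| + `|v * t| <= `|u| * c + `|v| * c.
  by move=> sc tc; rewrite !normrM lerD// ler_wpM2l.
split; first exact: le_trans (ler_normB _ _) (bound _ _ _ _ ac bc).
exact: le_trans (ler_normD _ _) (bound _ _ _ _ bc ac).
Qed.

(** An eigenvector is [lambda^-1] times its own image, and a bounded kernel has bounded images. The
    curried [s] covers both the operator and its adjoint. *)
Lemma cintegral_eigenvector_bounded (s : T -> T -> R) lambda e c :
  lambda != 0 -> 0 <= c -> L2C e -> (forall x, measurable_fun setT (s x)) ->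
  {ae m, forall x, {ae m, forall y, `|s x y| <= c}} ->
  {ae m, forall x, cintegral (fun y => (s x y)%:C * e y)%C = lambda * e x} ->
  exists2 c', 0 <= c' & {ae m, forall x, `|complex.Re (e x)| <= c' /\
                                         `|complex.Im (e x)| <= c'}.
Proof.
move=> l0 c0 eL ms sc eE.
have Re0 : 0 <= c * \int[m]_x `|complex.Re (e x)| by rewrite mulr_ge0// Rintegral_ge0.
have Im0 : 0 <= c * \int[m]_x `|complex.Im (e x)| by rewrite mulr_ge0// Rintegral_ge0.
apply: (Re_Im_bounded_mulI l0 (addr_ge0 Re0 Im0)).
apply: filterS2 eE sc => x <- sxc.
have [Re_le Im_le] := normr_cintegral_mul_le eL c0 (ms x) sxc.
by split; [rewrite (le_trans Re_le)// lerDl|rewrite (le_trans Im_le)// lerDr].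
Qed.

Lemma eigenvector_bounded k lambda e : k \in Lfun m2 +oo%E -> lambda != 0 ->
  eigenvector (integral_op k) lambda e ->
  exists2 c, 0 <= c & {ae m, forall x, `|complex.Re (e x)| <= c /\
                                       `|complex.Im (e x)| <= c}.
Proof.
move=> /Lfun_inftyP[mk [c c0 kc]] l0 [eL _ eE].
apply: (cintegral_eigenvector_bounded l0 c0 eL _ (ae_xsection kc) eE) => x.
exact: measurable_fun_pair2.
Qed.

Lemma eigenvector_adj_bounded k lambda e : k \in Lfun m2 +oo%E -> lambda != 0 ->
  eigenvector (integral_op_adj k) lambda e ->
  exists2 c, 0 <= c & {ae m, forall x, `|complex.Re (e x)| <= c /\
                                       `|complex.Im (e x)| <= c}.
Proof.
move=> /Lfun_inftyP[mk [c c0 kc]] l0 [eL _ eE].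
apply: (cintegral_eigenvector_bounded l0 c0 eL _ (ae_ysection kc) eE) => y.
exact: measurable_fun_pair1.
Qed.

(** [E(x, y)] is the real part of [ehat x] times the conjugate of [lambda * e y], hence a
    combination of four tensor products of real L2 functions. *)
Lemma Lfun2_Ekernel lambda e ehat : L2C e -> L2C ehat ->
  Ekernel lambda e ehat \in Lfun m2 2%:E.
Proof.
move=> [Re_e Im_e] [Re_h Im_h].
pose t (u v : T -> R) (z : T * T) := u z.1 * v z.2.
(* The signs are arranged so that only differences and scalar multiples occur. *)
have -> : Ekernel lambda e ehat = fun z =>
    complex.Re lambda * t (fun x => complex.Re (ehat x)) (fun y => complex.Re (e y)) z
    - (- complex.Re lambda) * t (fun x => complex.Im (ehat x)) (fun y => complex.Im (e y)) z
    - (- complex.Im lambda) * t (fun x => complex.Im (ehat x)) (fun y => complex.Re (e y)) z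
    - complex.Im lambda * t (fun x => complex.Re (ehat x)) (fun y => complex.Im (e y)) z.
  by apply/funext => z; rewrite /Ekernel /t /=; ring.
do 3! [apply: Lfun2B; last by apply: Lfun2Z; exact: Lfun2_tensor].
by apply: Lfun2Z; exact: Lfun2_tensor.
Qed.

Lemma Lfun_infty_Ekernel lambda e ehat c c' : L2C e -> L2C ehat ->
  0 <= c -> 0 <= c' ->
  {ae m, forall y, `|complex.Re (e y)| <= c /\ `|complex.Im (e y)| <= c} ->
  {ae m, forall x, `|complex.Re (ehat x)| <= c' /\ `|complex.Im (ehat x)| <= c'} ->
  Ekernel lambda e ehat \in Lfun m2 +oo%E.
Proof.
move=> eL hL c0 c'0 ec hc; apply/Lfun_inftyP; split.
  exact: Lfun_measurable (Lfun2_Ekernel lambda eL hL).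
exists ((c' * c + c' * c) * `|complex.Re lambda| +
  (c' * c + c' * c) * `|complex.Im lambda|).
  by rewrite addr_ge0// mulr_ge0// addr_ge0// mulr_ge0.
apply: filterS2 (ae_snd m ec) (ae_fst m hc) => z [Re_e Im_e] [Re_h Im_h].
rewrite (le_trans (ler_normD _ _))// !normrM lerD// ler_wpM2r//.
  by rewrite (le_trans (ler_normD _ _))// !normrM lerD// ler_pM.
by rewrite (le_trans (ler_normB _ _))// !normrM lerD// ler_pM.
Qed.

(** * The level set and the norm constraint *)

Lemma measurable_Flev k l : measurable_fun setT k -> measurable (Flev k l).
Proof.
move=> mk.
have -> : Flev k l = (fst @^-1` `[0, 1]) `&` (snd @^-1` `[0, 1]) `&` (k @^-1` `[l, +oo[).
  apply/seteqP; split=> z; rewrite /Flev /= !in_itv/= andbT; first by move=> [? ? ?].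
  by move=> [[? ?] ?].
apply: measurableI; first apply: measurableI.
- by rewrite -[X in measurable X]setTI; exact: measurable_fst.
- by rewrite -[X in measurable X]setTI; exact: measurable_snd.
- by rewrite -[X in measurable X]setTI; exact: mk.
Qed.

Lemma normL2_sqr k : k \in Lfun m2 2%:E ->
  (normL2 k ^+ 2 = (\int[m2]_z k z ^+ 2)%:E)%E.
Proof.
move=> kL; rewrite /normL2 Lnorm2_sqr fineK//.
exact: integrable_fin_num (Lfun2_integrable_sqr kL).
Qed.

Lemma normL2_eq1 k : k \in Lfun m2 2%:E ->
  normL2 k = 1%E <-> \int[m2]_z k z ^+ 2 = 1.
Proof.
move=> kL; have := normL2_sqr kL; have : (0 <= normL2 k)%E by exact: Lnorm_ge0.
(* An infinite norm is excluded because its square would be infinite. *)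
case: (normL2 k) => [r||//]; last by rewrite expe2 mulyy.
rewrite lee_fin -EFin_expe => r0 [<-]; split=> [[->]|/eqP]; first by rewrite expr1n.
by rewrite sqrp_eq1// => /eqP ->.
Qed.

(** Turns the extended-real constraint into the real integral used in [unit_sphere_minimiser]. *)
Lemma admissibleP k0 l k : admissible k0 l k <->
  ((Vker `&` supported_in (Flev k0 l)) `&` [set k | \int[m2]_z k z ^+ 2 = 1]) k.
Proof.
have sqrE : Vker k ->
    (normL2 k ^+ 2 - 1 = 0)%E <-> \int[m2]_z k z ^+ 2 = 1.
  move=> kV; rewrite (normL2_sqr kV.1) -EFinB.
  by split=> [[/subr0_eq]//|->]; rewrite subrr.
by split=> -[[kV kS] k1]; split=> //; exact/sqrE.
Qed.

End eigenvectors.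

(** * Existence, uniqueness and boundedness of the optimal kernel *)

Theorem theorem5p6 (R : realType) (l : R)
    (k0 : measurableTypeR R * measurableTypeR R -> R) (lambda0 : R[i])
    (e ehat : measurableTypeR R -> R[i]) (Xi' : set (measurableTypeR R)) :
  let E := Ekernel lambda0 e ehat in
  let F := Flev k0 l in
  0 < l -> l < 1 ->
  k0 \in Lfun (leb01sq R) 2%:E ->
  stochastic_kernel k0 ->
  mixing (integral_op k0) ->
  geometrically_simple_eigenvalue (integral_op k0) lambda0 ->
  `|lambda0| < 1 ->
  eigenvector (integral_op k0) lambda0 e ->
  eigenvector (integral_op_adj k0) lambda0 ehat ->
  measurable Xi' ->
  Xi' `<=` Xi F ->
  (0 < leb01 R Xi')%E ->
  (forall y, Xi' y ->
    (0 < \int[leb01 R]_(x in ysection F y) (E^\+ (x, y))%:E)%E /\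
    (0 < \int[leb01 R]_(x in ysection F y) (E^\- (x, y))%:E)%E) ->
  (exists alpha : R, 0 < alpha /\ normL2 (kdot F E alpha) = 1%E) /\
  forall alpha : R, 0 < alpha -> normL2 (kdot F E alpha) = 1%E ->
    unique_minimiser (admissible k0 l) (fun k => dotL2 k E) (kdot F E alpha) /\
    (k0 \in Lfun (leb01sq R) +oo%E ->
     kdot F E alpha \in Lfun (leb01sq R) +oo%E).
Proof.
move=> E F _ _ k0L _ _ _ _ eE hE mXi' _ Xi'_gt0 Xi'E.
have eL : L2C e by case: eE.
have hatL : L2C ehat by case: hE.
have mF : measurable F := measurable_Flev l (Lfun_measurable k0L).
have EL : E \in Lfun (leb01sq R) 2%:E := Lfun2_Ekernel lambda0 eL hatL.
have Ei := Lfun2_integrable EL.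
have hL := Lfun2_kdot 1 mF EL.
have h_gt0 : 0 < \int[leb01sq R]_z kdot F E 1 z ^+ 2.
  rewrite lt_neqAle Rintegral_ge0 ?andbT; last by move=> z _; exact: sqr_ge0.
  (* If the kernel vanished, the sign conditions would fail off a null set [N]; they hold on [Xi'],
     which would then lie in [N]. *)
  apply/eqP => /esym/(Rintegral_sqr_eq0 hL)/(kdot_eq0 mF Ei)[N [mN N0 subN]].
  move: Xi'_gt0; rewrite ltNge -N0 => /negP; apply.
  apply: le_measure; rewrite ?inE// => y Xy; apply: subN => /=.
  by apply; exact: Xi'E.
split.
  (* The normalising constant is the L2 norm of [kdot F E 1]. *)
  exists (Num.sqrt (\int[leb01sq R]_z kdot F E 1 z ^+ 2)); rewrite sqrtr_gt0; split=> //.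
  apply/(normL2_eq1 (Lfun2_kdot _ mF EL)); rewrite kdotZ.
  under eq_Rintegral do rewrite exprMn.
  rewrite RintegralZl//; last exact: Lfun2_integrable_sqr.
  by rewrite exprVn sqr_sqrtr ?(ltW h_gt0)// mulVf// gt_eqF.
move=> alpha alpha0 kdot1; split; last first.
  move=> k0_bd; apply: Lfun_infty_kdot => //.
  (* For eigenvalue 0 the eigenvectors cannot be bounded by dividing, but [E] is identically 0. *)
  have [l0|l0] := eqVneq lambda0 0.
    apply/Lfun_inftyP; split; first exact: Lfun_measurable EL.
    by exists 0 => //; apply: nearW => z; rewrite /E /Ekernel l0 /= !mulr0 addr0 normr0.
  have [c c0 ec] := eigenvector_bounded k0_bd l0 eE.
  have [c' c'0 hc] := eigenvector_adj_bounded k0_bd l0 hE.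
  exact: Lfun_infty_Ekernel ec hc.
have kdotA : admissible k0 l (kdot F E alpha).
  apply/admissibleP; split.
    by split; [exact: Vker_kdot|exact: supported_in_kdot].
  by apply/(normL2_eq1 (Lfun2_kdot _ mF EL)).
have WL : Vker `&` supported_in F `<=` [set k | k \in Lfun (leb01sq R) 2%:E].
  by move=> k [[kL _] _].
have WE k : (Vker `&` supported_in F) k ->
    \int[leb01sq R]_z (k z * E z) = - \int[leb01sq R]_z (k z * kdot F E 1 z).
  by move=> [kV kS]; exact: dotL2_kdot.
(* The objective is minus the product with [kdot F E 1], here a positive multiple of the unit vector
   [kdot F E alpha]. *)
have hE1 z : kdot F E 1 z = alpha * kdot F E alpha z.
  by rewrite (kdotZ F E alpha) mulrA divff ?gt_eqF// mul1r.
have kdotA' := (admissibleP k0 l _).1 kdotA.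
have [kdot_min kdot_uniq] := unit_sphere_minimiser WL WE alpha0 hE1 kdotA'.
split; first by split=> // k /admissibleP; exact: kdot_min.
move=> k [/admissibleP kA kmin]; apply: kdot_uniq => //.
exact: kmin.
Qed.
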